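(* Let $k$ be a field of characteristic zero, and let $\mathcal{A}:=k[[x]][x^{-1}]$ be the localization of the formal power series algebra $k[[x]]=k[[x_1,\dots,x_n]]$ in the elements $x_1,\dots,x_n$. If $\phi:\mathcal{A}\to\mathcal{A}$ is a locally finite $k$-algebra homomorphism, then there exist integers $1\le i<j$ such that $\phi^i=\phi^j$. In particular, $\operatorname{Im}(1-\phi)$ is a Mathieu-Zhao space of $\mathcal{A}$.
   Context: Here $1$ denotes the identity map of $\mathcal{A}$ and $\phi^i$ denotes the $i$-fold composition. A $k$-linear map $T:\mathcal{A}\to\mathcal{A}$ is locally finite if for each $a\in\mathcal{A}$ the $k$-subspace spanned by the elements $T^m(a)$ ($m\ge 0$) is finite dimensional over $k$. For a $k$-subspace $M$ of a commutative $k$-algebra $\mathcal{A}$, the radical $\mathfrak{r}(M)$ is the set of $a\in\mathcal{A}$ such that $a^m\in M$ for all sufficiently large $m$. The subspace $M$ is a Mathieu-Zhao space (MZ-space) of $\mathcal{A}$ if for every $a\in\mathfrak{r}(M)$ and every $b\in\mathcal{A}$ there exists $N_b\ge 1$ such that $ba^m\in M$ for all $m\ge N_b$. *)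

(* Defs.v *)
From HB Require Import structures.
From mathcomp Require Import all_boot all_order all_algebra.
From mathcomp Require Import boolp classical_sets.
From mathcomp Require Import generic_quotient ring mpoly.

Set Implicit Arguments.
Unset Strict Implicit.
Unset Printing Implicit Defensive.

Import GRing.Theory.

Local Open Scope ring_scope.

(* The algebra R[[x_1, .., x_n]]. A series is the family of its coefficients,
   indexed by the multi-exponents m : 'X_{1..n}. *)

Record mseries (n : nat) (R : Type) := MSeries { scoef : 'X_{1..n} -> R }.

Arguments MSeries {n R} _.

HB.instance Definition _ n R := gen_eqMixin (mseries n R).
HB.instance Definition _ n R := gen_choiceMixin (mseries n R).

Lemma mseriesP n R (f g : mseries n R) : scoef f =1 scoef g -> f = g.
Proof. by case: f g => [f] [g] /= /funext ->. Qed.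

Section SeriesRing.
Variables (n : nat) (R : comNzRingType).

Local Notation S := (mseries n R).
Implicit Types (f g h : S) (m : 'X_{1..n}).

Definition sadd f g : S := MSeries (fun m => scoef f m + scoef g m).
Definition sopp f : S := MSeries (fun m => - scoef f m).
Definition szero : S := MSeries (fun=> 0).
Definition sone : S := MSeries (fun m => (m == 0%MM)%:R).
Definition sscale (c : R) f : S := MSeries (fun m => c * scoef f m).

(* The Cauchy product; the degree bound only serves to make the index set of
   the sum over m = m1 + m2 a finite type. *)
Definition smul f g : S := MSeries (fun m =>
  \sum_(k : 'X_{1..n < (mdeg m).+1, (mdeg m).+1} | m == (k.1 + k.2)%MM)
     scoef f k.1 * scoef g k.2).

Lemma saddA : associative sadd.
Proof. by move=> f g h; apply: mseriesP => m /=; rewrite addrA. Qed.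

Lemma saddC : commutative sadd.
Proof. by move=> f g; apply: mseriesP => m /=; rewrite addrC. Qed.

Lemma sadd0 : left_id szero sadd.
Proof. by move=> f; apply: mseriesP => m /=; rewrite add0r. Qed.

Lemma saddN : left_inverse szero sopp sadd.
Proof. by move=> f; apply: mseriesP => m /=; rewrite addNr. Qed.

HB.instance Definition _ := GRing.isZmodule.Build S saddA saddC sadd0 saddN.

(* The ring axioms are transferred from {mpoly R[n]} by truncation. *)
Definition strunc d f : {mpoly R[n]} :=
  \sum_(m : 'X_{1..n < d}) (scoef f m *: 'X_[m]).

Lemma struncE d f m : (mdeg m < d)%N -> (strunc d f)@_m = scoef f m.
Proof. by move=> lt_md; rewrite /strunc (mcoeff_mpoly (scoef f)). Qed.

Lemma smulE_low (p q : {mpoly R[n]}) f g m :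
    (forall l, (mdeg l <= mdeg m)%N -> p@_l = scoef f l) ->
    (forall l, (mdeg l <= mdeg m)%N -> q@_l = scoef g l) ->
  scoef (smul f g) m = (p * q)@_m.
Proof.
move=> pf qg; rewrite mcoeffM /=; apply: eq_bigr => -[k1 k2] /= _.
by rewrite pf ?qg // -ltnS bmdeg.
Qed.

Lemma smulE d f g m : (mdeg m < d)%N ->
  scoef (smul f g) m = (strunc d f * strunc d g)@_m.
Proof.
by move=> md; apply: smulE_low => l lm; apply: struncE; apply: leq_ltn_trans md.
Qed.

Lemma smulC : commutative smul.
Proof.
move=> f g; apply: mseriesP => m.
by rewrite !(smulE (d := (mdeg m).+1)) // mulrC.
Qed.

Lemma smulA : associative smul.
Proof.
move=> f g h; apply: mseriesP => m; pose d := (mdeg m).+1.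
rewrite (@smulE_low (strunc d f) (strunc d g * strunc d h)); last first.
- by move=> l lm; rewrite (smulE (d := d)).
- by move=> l lm; rewrite struncE.
rewrite (@smulE_low (strunc d f * strunc d g) (strunc d h)) ?mulrA //.
- by move=> l lm; rewrite (smulE (d := d)).
- by move=> l lm; rewrite struncE.
Qed.

Lemma smul1 : left_id sone smul.
Proof.
move=> f; apply: mseriesP => m.
rewrite (@smulE_low 1 (strunc (mdeg m).+1 f)); last first.
- by move=> l lm; rewrite struncE.
- by move=> l _; rewrite mcoeff1.
by rewrite mul1r struncE.
Qed.

Lemma smulDl : left_distributive smul sadd.
Proof.
move=> f g h; apply: mseriesP => m /=.
by rewrite -big_split /=; apply: eq_bigr => k _; rewrite mulrDl.
Qed.

Lemma sone_neq0 : sone != 0 :> S.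
Proof.
apply/eqP => /(congr1 (fun f => scoef f 0%MM)) /= /eqP.
by rewrite eqxx oner_eq0.
Qed.

HB.instance Definition _ :=
  GRing.Zmodule_isComNzRing.Build S smulA smulC smul1 smulDl sone_neq0.

Lemma sscaleA a b f : sscale a (sscale b f) = sscale (a * b) f.
Proof. by apply: mseriesP => m /=; rewrite mulrA. Qed.

Lemma sscale1 : left_id 1 sscale.
Proof. by move=> f; apply: mseriesP => m /=; rewrite mul1r. Qed.

Lemma sscaleDr : right_distributive sscale +%R.
Proof. by move=> a f g; apply: mseriesP => m /=; rewrite mulrDr. Qed.

Lemma sscaleDl f : {morph sscale^~ f : a b / a + b}.
Proof. by move=> a b; apply: mseriesP => m /=; rewrite mulrDl. Qed.

HB.instance Definition _ :=
  GRing.Zmodule_isLmodule.Build R S sscaleA sscale1 sscaleDr sscaleDl.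

Lemma sscaleAl (a : R) f g : a *: (f * g) = a *: f * g.
Proof.
apply: mseriesP => m /=; rewrite mulr_sumr.
by apply: eq_bigr => k _; rewrite mulrA.
Qed.

HB.instance Definition _ := GRing.Lmodule_isLalgebra.Build R S sscaleAl.

Lemma sscaleAr (a : R) f g : a *: (f * g) = f * (a *: g).
Proof. by rewrite mulrC sscaleAl mulrC. Qed.

HB.instance Definition _ := GRing.Lalgebra_isAlgebra.Build R S sscaleAr.

Definition svar (i : 'I_n) : S := MSeries (fun m => (m == U_(i)%MM)%:R).

Definition smon m : S := \prod_(i < n) svar i ^+ m i.

Lemma smon0 : smon 0%MM = 1.
Proof. by rewrite /smon big1 // => i _; rewrite mnm0E. Qed.

Lemma smonD m l : smon (m + l)%MM = smon m * smon l.
Proof.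
by rewrite /smon -big_split; apply: eq_bigr => i _ /=; rewrite mnmDE exprD.
Qed.

Lemma smonU i : smon U_(i)%MM = svar i.
Proof.
rewrite /smon (bigD1 i) //= big1 ?mulr1 => [|j ji]; rewrite mnm1E ?eqxx //.
by rewrite eq_sym (negPf ji).
Qed.

Lemma scoef_mul_svar f i m : scoef (f * svar i) (U_(i) + m)%MM = scoef f m.
Proof.
rewrite (@smulE_low (strunc (mdeg (U_(i) + m)%MM).+1 f) 'X_i) ?mcoeffMX.
- by rewrite struncE // mdegD mdeg1 add1n ltnW.
- by move=> l lm; rewrite struncE.
- by move=> l _; rewrite mcoeffX eq_sym.
Qed.

Lemma svarI i : injective ( *%R^~ (svar i)).
Proof.
move=> f g /= fg; apply: mseriesP => m.
by rewrite -(scoef_mul_svar f i) fg scoef_mul_svar.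
Qed.

Lemma smonI m : injective ( *%R^~ (smon m)).
Proof.
rewrite /smon; elim/big_rec: _ => [|i h _ hI] f g /=; first by rewrite !mulr1.
rewrite !mulrA => /hI; elim: (m i) => [|e IHe]; first by rewrite expr0 !mulr1.
by rewrite exprSr !mulrA => /svarI.
Qed.

End SeriesRing.

Arguments svar {n R} i.
Arguments smon {n R} m.

(* The localization R[[x]][x^-1] of R[[x]] at the multiplicative set generated
   by x_1, .., x_n. The pair (f, m) stands for the fraction f / x^m. *)

Module LaurentDef.
Section LaurentDef.
Variables (n : nat) (R : comNzRingType).

Local Notation frac := (mseries n R * 'X_{1..n})%type.
Implicit Types (x y z : frac).

(* Monomials are regular elements, so that no further monomial factor is needed
   in this equation. *)
Definition eqfrac x y := x.1 * smon y.2 == y.1 * smon x.2.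

Lemma eqfrac_refl : reflexive eqfrac.
Proof. by move=> x; rewrite /eqfrac. Qed.

Lemma eqfrac_sym : ssrbool.symmetric eqfrac.
Proof. by move=> x y; rewrite /eqfrac eq_sym. Qed.

Lemma eqfrac_trans : transitive eqfrac.
Proof.
move=> y x z; rewrite /eqfrac => /eqP xy /eqP yz; apply/eqP.
by apply: (@smonI _ _ y.2); rewrite mulrAC xy mulrAC yz mulrAC.
Qed.

Canonical eqfrac_equiv := EquivRel eqfrac eqfrac_refl eqfrac_sym eqfrac_trans.

Local Open Scope quotient_scope.

Definition type := {eq_quot eqfrac}.

HB.instance Definition _ : EqQuotient _ eqfrac type := EqQuotient.on type.
HB.instance Definition _ := Choice.on type.

Lemma repr_pi x :
  (repr (\pi_type x)).1 * smon x.2 = x.1 * smon (repr (\pi_type x)).2.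
Proof. by apply/eqP; rewrite -[_ == _]/(eqfrac _ _) -eqmodE reprK. Qed.

Definition embed := lift_embed type (fun f : mseries n R => (f, 0%MM)).
Canonical embed_pi_morph := PiEmbed embed.

Definition addx x y : frac :=
  (x.1 * smon y.2 + y.1 * smon x.2, (x.2 + y.2)%MM).
Definition add := lift_op2 type addx.

Lemma pi_add : {morph \pi : x y / addx x y >-> add x y}.
Proof.
move=> x y; unlock add; apply/eqmodP; rewrite /= /eqfrac /addx /= !smonD.
have := repr_pi x; have := repr_pi y; set y' := repr _; set x' := repr _.
move=> ey ex; apply/eqP.
transitivity (x.1 * smon x'.2 * (smon y.2 * smon y'.2)
              + y.1 * smon y'.2 * (smon x.2 * smon x'.2)); first by ring.
by rewrite -ex -ey; ring.
Qed.
Canonical pi_add_morph := PiMorph2 pi_add.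

Definition oppx x : frac := (- x.1, x.2).
Definition opp := lift_op1 type oppx.

Lemma pi_opp : {morph \pi : x / oppx x >-> opp x}.
Proof.
move=> x; unlock opp; apply/eqmodP; rewrite /= /eqfrac /oppx /=.
by rewrite !mulNr repr_pi.
Qed.
Canonical pi_opp_morph := PiMorph1 pi_opp.

Definition mulx x y : frac := (x.1 * y.1, (x.2 + y.2)%MM).
Definition mul := lift_op2 type mulx.

Lemma pi_mul : {morph \pi : x y / mulx x y >-> mul x y}.
Proof.
move=> x y; unlock mul; apply/eqmodP; rewrite /= /eqfrac /mulx /= !smonD.
by rewrite mulrACA -!repr_pi mulrACA.
Qed.
Canonical pi_mul_morph := PiMorph2 pi_mul.

Definition scalex (c : R) x : frac := (c *: x.1, x.2).
Definition scale c := lift_op1 type (scalex c).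

Lemma pi_scale c : {morph \pi : x / scalex c x >-> scale c x}.
Proof.
move=> x; unlock scale; apply/eqmodP; rewrite /= /eqfrac /scalex /=.
by rewrite -!scalerAl repr_pi.
Qed.
Canonical pi_scale_morph c := PiMorph1 (pi_scale c).

Lemma pi_eq x y : x.1 * smon y.2 = y.1 * smon x.2 -> x = y %[mod type].
Proof. by move=> xy; apply/eqmodP/eqP. Qed.

Lemma addA : associative add.
Proof.
elim/quotW=> x; elim/quotW=> y; elim/quotW=> z; rewrite !piE.
by apply: pi_eq; rewrite /addx /= !smonD; ring.
Qed.

Lemma addC : commutative add.
Proof.
elim/quotW=> x; elim/quotW=> y; rewrite !piE.
by apply: pi_eq; rewrite /addx /= !smonD; ring.
Qed.

Lemma add0 : left_id (embed 0) add.
Proof.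
elim/quotW=> x; rewrite !piE.
by apply: pi_eq; rewrite /addx /= !smonD smon0; ring.
Qed.

Lemma addN : left_inverse (embed 0) opp add.
Proof.
elim/quotW=> x; rewrite !piE.
by apply: pi_eq; rewrite /addx /oppx /= !smonD smon0; ring.
Qed.

HB.instance Definition _ := GRing.isZmodule.Build type addA addC add0 addN.

Lemma mulA : associative mul.
Proof.
elim/quotW=> x; elim/quotW=> y; elim/quotW=> z; rewrite !piE.
by apply: pi_eq; rewrite /mulx /= !smonD; ring.
Qed.

Lemma mulC : commutative mul.
Proof.
elim/quotW=> x; elim/quotW=> y; rewrite !piE.
by apply: pi_eq; rewrite /mulx /= !smonD; ring.
Qed.

Lemma mul1 : left_id (embed 1) mul.
Proof.
elim/quotW=> x; rewrite !piE.
by apply: pi_eq; rewrite /mulx /= !smonD smon0; ring.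
Qed.

Lemma mulDl : left_distributive mul add.
Proof.
elim/quotW=> x; elim/quotW=> y; elim/quotW=> z; rewrite !piE.
by apply: pi_eq; rewrite /mulx /addx /= !smonD; ring.
Qed.

Lemma embedI : injective embed.
Proof.
move=> f g; rewrite !piE => /eqmodP; rewrite /= /eqfrac /= smon0 !mulr1.
by move/eqP.
Qed.

Lemma one_neq0 : embed 1 != 0 :> type.
Proof. by apply/eqP => /embedI/eqP; rewrite oner_eq0. Qed.

HB.instance Definition _ :=
  GRing.Zmodule_isComNzRing.Build type mulA mulC mul1 mulDl one_neq0.

Lemma scaleA a b u : scale a (scale b u) = scale (a * b) u.
Proof.
elim/quotW: u => x; rewrite !piE.
by apply: pi_eq; rewrite /scalex /= scalerA.
Qed.

Lemma scale1 : left_id 1 scale.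
Proof.
elim/quotW=> x; rewrite !piE.
by apply: pi_eq; rewrite /scalex /= scale1r.
Qed.

Lemma scaleDr : right_distributive scale +%R.
Proof.
move=> a; elim/quotW=> x; elim/quotW=> y; rewrite !piE.
apply: pi_eq; rewrite /scalex /addx /= -!scalerAl -scalerDr.
by rewrite -!scalerAl.
Qed.

Lemma scaleDl u : {morph scale^~ u : a b / a + b}.
Proof.
move=> a b /=; elim/quotW: u => x; rewrite !piE.
apply: pi_eq; rewrite /scalex /addx /= scalerDl !smonD -mulrDl mulrA.
by rewrite mulrAC.
Qed.

HB.instance Definition _ :=
  GRing.Zmodule_isLmodule.Build R type scaleA scale1 scaleDr scaleDl.

Lemma scaleAl (a : R) (u v : type) : a *: (u * v) = a *: u * v.
Proof.
elim/quotW: u => x; elim/quotW: v => y.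
rewrite -[LHS]/(scale a (mul _ _)) -[RHS]/(mul (scale a _) _) !piE.
by apply: pi_eq; rewrite /scalex /mulx /= scalerAl.
Qed.

HB.instance Definition _ := GRing.Lmodule_isLalgebra.Build R type scaleAl.

Lemma scaleAr (a : R) (u v : type) : a *: (u * v) = u * (a *: v).
Proof. by rewrite mulrC scaleAl mulrC. Qed.

HB.instance Definition _ := GRing.Lalgebra_isAlgebra.Build R type scaleAr.

End LaurentDef.
End LaurentDef.
HB.export LaurentDef.

Notation laurent := LaurentDef.type.

Section LaurentTheory.
Variables (n : nat) (R : comNzRingType).

Local Notation S := (mseries n R).
Local Notation A := (laurent n R).

Definition tolaurent : S -> A := @LaurentDef.embed n R.

Lemma tolaurent_is_zmod_morphism : zmod_morphism tolaurent.
Proof.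
move=> f g; rewrite /tolaurent /=.
rewrite -[X in _ = X]/(LaurentDef.add _ (LaurentDef.opp _)) !piE.
apply: LaurentDef.pi_eq.
by rewrite /LaurentDef.addx /LaurentDef.oppx /= smonD !smon0; ring.
Qed.

HB.instance Definition _ :=
  GRing.isZmodMorphism.Build S A tolaurent tolaurent_is_zmod_morphism.

Lemma tolaurent_is_monoid_morphism : monoid_morphism tolaurent.
Proof.
split=> [//|f g]; rewrite /tolaurent -[X in _ = X]/(LaurentDef.mul _ _) !piE.
by apply: LaurentDef.pi_eq; rewrite /LaurentDef.mulx /= smonD !smon0; ring.
Qed.

HB.instance Definition _ :=
  GRing.isMonoidMorphism.Build S A tolaurent tolaurent_is_monoid_morphism.

Lemma tolaurent_is_scalable : scalable tolaurent.
Proof.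
move=> c f; rewrite /tolaurent -[X in _ = X]/(LaurentDef.scale _ _) !piE.
exact: LaurentDef.pi_eq.
Qed.

HB.instance Definition _ :=
  GRing.isScalable.Build R S A *:%R tolaurent tolaurent_is_scalable.

Lemma tolaurent_inj : injective tolaurent.
Proof. exact: LaurentDef.embedI. Qed.

Lemma laurent_var_unit (i : 'I_n) : exists u : A, u * tolaurent (svar i) = 1.
Proof.
exists (\pi_A (1, U_(i)%MM))%qT; rewrite -[LHS]/(LaurentDef.mul _ _).
rewrite -[RHS]/(LaurentDef.embed 1) /tolaurent !piE.
by apply: LaurentDef.pi_eq; rewrite /= !(smonD, smonU, smon0); ring.
Qed.

Lemma laurent_fracP (u : A) :
  exists f m, u * tolaurent (smon m) = tolaurent f.
Proof.
elim/quotW: u => -[f m]; exists f, m; rewrite -[LHS]/(LaurentDef.mul _ _).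
rewrite /tolaurent !piE.
by apply: LaurentDef.pi_eq; rewrite /= !(smonD, smon0); ring.
Qed.

End LaurentTheory.

Local Open Scope classical_set_scope.

Section LinearNotions.
Variables (k : fieldType) (V : lmodType k).

Definition is_subspace (M : set V) : Prop :=
  M 0 /\ forall (c : k) (u v : V), M u -> M v -> M (c *: u + v).

Definition lspan (E : set V) : set V :=
  [set v | exists (d : nat) (c : 'I_d -> k) (e : 'I_d -> V),
             (forall i, E (e i)) /\ v = \sum_(i < d) c i *: e i].

Definition finite_dimensional (M : set V) : Prop :=
  exists (d : nat) (e : 'I_d -> V), M = lspan (range e).

Definition locally_finite (T : {linear V -> V}) : Prop :=
  forall a : V, finite_dimensional (lspan (range (fun m : nat => iter m T a))).

End LinearNotions.

Section MathieuZhao.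
Variables (k : fieldType) (A : comAlgType k).

Definition mz_radical (M : set A) : set A :=
  [set a | exists N : nat, forall m : nat, (N <= m)%N -> M (a ^+ m)].

Definition MZ_space (M : set A) : Prop :=
  is_subspace M /\
  forall a b : A, mz_radical M a ->
    exists2 N : nat, (1 <= N)%N &
      forall m : nat, (N <= m)%N -> M (b * a ^+ m).

End MathieuZhao.

(* Main.v *)
Require Import Defs.
From HB Require Import structures.
From mathcomp Require Import all_boot all_order all_algebra.
From mathcomp Require Import boolp classical_sets.
From mathcomp Require Import mpoly ring zify.

(** Write S for the ring k[[x]], m for its maximal ideal and A for its
   localization at the variables.

   Continuity comes for free. If f is in m, then 1 + f is a 2^e-th power for
   every e, so phi (1 + f) is infinitely 2-divisible in A. The x_i-adic
   valuation of such an element is 0 for each i, hence phi (1 + f) is a series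
   ([infinitely_divisible_integral]). If the series phi f had a constant term
   a <> 0, then the invertible element 1 - f / a would be mapped to a series
   without constant term whose inverse is also a series, which is absurd. Thus
   phi restricts to an endomorphism psi of S with psi (m) in m, and therefore
   psi (m^N) in m^N ([phi_restricts]).

   A linear endomorphism of S that preserves the filtration by the m^N and is
   locally algebraic is killed by a single nonzero polynomial p on some m^N
   ([locally_algebraic_tail]). This is Kaplansky's theorem on locally algebraic
   maps, in a version for complete spaces: otherwise one builds, by successively
   smaller corrections, a series annihilated by no p(psi).

   Multiplicativity then takes over. For f in m, all powers f^e with e >= N are
   killed by p(psi), so that sum_j p_j (psi^j f)^e = 0 for all e >= N. A
   Vandermonde argument ([weighted_power_sums]) shows that the orbit of f
   returns to an earlier value or to 0 within deg p steps, a bound that does not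
   depend on f. A common preperiod D and a common period D! follow, first on m,
   next on S = k + m, and finally on A, where the inverses of the monomials have
   no choice but to follow the monomials.

   Finally, once phi^i = phi^(i + q), characteristic zero turns membership of a
   in the image of 1 - phi into the equation sum_(t < q) phi^(i + t) a = 0. If
   all large powers of a satisfy it, the same Vandermonde argument gives
   phi^(i + t) a = 0 for each t, and then every b a^m satisfies it too. *)

Set Implicit Arguments.
Unset Strict Implicit.
Unset Printing Implicit Defensive.

Import Order.TTheory GRing.Theory.

Local Open Scope ring_scope.
Local Open Scope classical_set_scope.

(** * Products with monomials *)

Section Coefficients.
Variables (n : nat) (R : comNzRingType).
Implicit Types (f g : mseries n R) (m l : 'X_{1..n}).

Lemma scoefM f g m : scoef (f * g) m =
  \sum_(k : 'X_{1..n < (mdeg m).+1, (mdeg m).+1} | m == (k.1 + k.2)%MM)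
     scoef f k.1 * scoef g k.2.
Proof. by []. Qed.

Lemma scoefD f g m : scoef (f + g) m = scoef f m + scoef g m.
Proof. by []. Qed.

Lemma scoefN f m : scoef (- f) m = - scoef f m.
Proof. by []. Qed.

Lemma scoefB f g m : scoef (f - g) m = scoef f m - scoef g m.
Proof. by []. Qed.

Lemma scoefZ (c : R) f m : scoef (c *: f) m = c * scoef f m.
Proof. by []. Qed.

Lemma scoef0 m : scoef (0 : mseries n R) m = 0.
Proof. by []. Qed.

Lemma scoef1 m : scoef (1 : mseries n R) m = (m == 0%MM)%:R.
Proof. by []. Qed.

Lemma mseries_neq0 f : f != 0 -> exists m, scoef f m != 0.
Proof.
move=> f0; apply: contrapT => /forallNP H; case/eqP: f0.
by apply: mseriesP => m; apply/eqP/negPn/negP/H.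
Qed.

(** A monomial is a polynomial, and the product of two polynomials has the
   same coefficients whether it is taken among polynomials or among series. *)
Lemma scoef_smon m l : scoef (smon m : mseries n R) l = (l == m)%:R.
Proof.
pose E (p : {mpoly R[n]}) : mseries n R := MSeries (fun m => p@_m).
have EM : {morph E : p q / p * q}.
  by move=> p q; apply: mseriesP => j; rewrite (@smulE_low _ _ p q).
have E1 : E 1 = 1 by apply: mseriesP => j /=; rewrite mcoeff1.
have EX i e : E ('X_i ^+ e) = svar i ^+ e.
  elim: e => [|e IHe]; first by rewrite !expr0.
  rewrite !exprS EM IHe; congr (_ * _).
  by apply: mseriesP => j /=; rewrite mcoeffX eq_sym.
have -> : smon m = E 'X_[m].
  by rewrite mpolyXE_id (big_morph E EM E1); apply: eq_bigr => i _; rewrite EX.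
by rewrite /= mcoeffX eq_sym.
Qed.

Lemma scoef_mul_smon f m l :
  scoef (f * smon m) l = if (m <= l)%MM then scoef f (l - m)%MM else 0.
Proof.
rewrite (@smulE_low _ _ (strunc (mdeg l).+1 f) 'X_[m]); last first.
- by move=> j _; rewrite mcoeffX scoef_smon eq_sym.
- by move=> j jl; rewrite struncE.
case: ifPn => ml.
  rewrite -{1}(submK ml) addmC mcoeffMX struncE //.
  exact: leq_trans (mdegB _ _) _.
apply/eqP; rewrite mcoeff_eq0; apply/negP => /msuppM_le /allpairsP.
case=> -[a b] /= [_]; rewrite msuppX inE => /eqP -> le.
by case/negP: ml; rewrite le lem_addl.
Qed.

End Coefficients.

(** * Weights of power series *)

Section Weights.
Variables (n : nat) (R : idomainType) (w : 'X_{1..n} -> nat).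
Hypothesis wD : forall m l, w (m + l)%MM = (w m + w l)%N.
Implicit Types (f g : mseries n R) (m l : 'X_{1..n}).

(** The weight w is additive; with w m := m i, the number a is the x_i-adic
   valuation of f. *)
Definition has_weight f a :=
  (exists2 m, scoef f m != 0 & w m = a) /\
  (forall m, scoef f m != 0 -> (a <= w m)%N).

(** Ties in weight are broken by the monomial order, so that the lowest monomial
   is unique and the lowest coefficients of two series multiply. *)
Definition wlead f m :=
  scoef f m != 0 /\ forall l, scoef f l != 0 ->
    (w m < w l)%N || (w m == w l) && (m <= l)%O.

Lemma wlead_exists f : f != 0 -> exists m, wlead f m.
Proof.
move=> /mseries_neq0[m0 fm0].
pose W a := `[< exists2 m, scoef f m != 0 & w m = a >].
have exW : exists a, W a by exists (w m0); apply/asboolP; exists m0.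
have [m1 fm1 wm1] : exists2 m, scoef f m != 0 & w m = ex_minn exW.
  by case: ex_minnP => a /asboolP.
have minW l : scoef f l != 0 -> (ex_minn exW <= w l)%N.
  by move=> fl; case: ex_minnP => a _; apply; apply/asboolP; exists l.
elim/(well_founded_ind (@ltom_wf n)): m1 fm1 wm1 => m1 IH fm1 wm1.
have [[l [fl wl lm]]|no] :=
  pselect (exists l, [/\ scoef f l != 0, w l = w m1 & (l < m1)%O]).
  by apply: (IH l lm fl); rewrite wl.
exists m1; split=> // l fl.
have:= minW l fl; rewrite -wm1 leq_eqVlt orbC => /orP[->//|/eqP wml].
rewrite wml eqxx /= leNgt; apply/orP; right; apply/negP => lm; apply: no.
by exists l.
Qed.

Lemma wlead_weight f m : wlead f m -> has_weight f (w m).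
Proof.
by case=> fm min; split=> [|l /min/orP[/ltnW//|/andP[/eqP->]]//]; exists m.
Qed.

(** A factorization of m + l into monomials of f and g other than (m, l) would
   have the same weight, hence exceed m + l in the monomial order. *)
Lemma wleadM f g m l : wlead f m -> wlead g l ->
  scoef (f * g) (m + l) = scoef f m * scoef g l.
Proof.
move=> [fm minf] [gl ming]; rewrite scoefM.
have bm : (mdeg m < (mdeg (m + l)).+1)%N by rewrite mdegD ltnS leq_addr.
have bl : (mdeg l < (mdeg (m + l)).+1)%N by rewrite mdegD ltnS leq_addl.
rewrite (bigD1 (BMultinom bm, BMultinom bl)) //= big1 ?addr0 // =>
  -[[a ba] [b bb]] /= /andP[/eqP e ne]; apply/eqP; rewrite mulf_eq0; apply: contraNT ne.
rewrite negb_or => /andP[fa gb].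
have := congr1 w e; rewrite !wD => we.
have := minf _ fa; have := ming _ gb.
case: ltngtP => //= [|wl lb]; first by case: ltngtP => //= ? _; lia.
case: ltngtP => //= [|wm ma]; first by lia.
suff am : a = m.
  have lb' : l = b by move: e; rewrite am => /addmI.
  by rewrite xpair_eqE -!val_eqE /= am lb' !eqxx.
apply/eqP; rewrite eq_sym eq_le ma /= leNgt; apply/negP => lt_ma.
by have:= ltmc_le_add lt_ma lb; rewrite e ltxx.
Qed.

End Weights.

Section Domain.
Variables (n : nat) (R : idomainType).
Implicit Types (f g : mseries n R).

(** Lowest monomials for the weight 0 do not cancel. *)
Lemma mseries_mulf_neq0 f g : f != 0 -> g != 0 -> f * g != 0.
Proof.
have wD (m l : 'X_{1..n}) : (fun=> 0%N) (m + l)%MM = (0 + 0)%N by [].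
move=> /(wlead_exists (fun=> 0%N))[m lm] /(wlead_exists (fun=> 0%N))[l ll].
apply/eqP => /(congr1 (fun h => scoef h (m + l)%MM))/eqP.
by rewrite (wleadM wD lm ll) mulf_eq0 (negPf lm.1) (negPf ll.1).
Qed.

Variable w : 'X_{1..n} -> nat.
Hypothesis wD : forall m l, w (m + l)%MM = (w m + w l)%N.

Lemma has_weight_uniq f a b : has_weight w f a -> has_weight w f b -> a = b.
Proof.
move=> [[m fm wm] mina] [[l fl wl] minb]; apply/eqP; rewrite eqn_leq.
by rewrite -{1}wl mina //= -wm minb.
Qed.

Lemma has_weight_exists f : f != 0 -> exists a, has_weight w f a.
Proof. by move=> /(wlead_exists w)[m /wlead_weight ?]; exists (w m). Qed.

Lemma weight_ge f g (a b : nat) :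
    (forall m, scoef f m != 0 -> (a <= w m)%N) ->
    (forall m, scoef g m != 0 -> (b <= w m)%N) ->
  forall m, scoef (f * g) m != 0 -> (a + b <= w m)%N.
Proof.
move=> fa gb m; rewrite leqNgt; apply: contra => lt_m.
rewrite scoefM big1 // => -[[c bc] [d bd]] /= /eqP e.
apply/eqP; rewrite mulf_eq0 -[_ || _]negbK negb_or; apply/negP => /andP[].
by move=> /fa + /gb; move: lt_m; rewrite e wD; lia.
Qed.

Lemma has_weightM f g a b :
  has_weight w f a -> has_weight w g b -> has_weight w (f * g) (a + b).
Proof.
move=> fa gb; split; last exact: weight_ge fa.2 gb.2.
have nz (h : mseries n R) c : has_weight w h c -> h != 0.
  by case=> -[m hm _] _; apply: contraNneq hm => ->.
have [m lm] := wlead_exists w (nz _ _ fa).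
have [l ll] := wlead_exists w (nz _ _ gb).
exists (m + l)%MM; first by rewrite (wleadM wD) // mulf_neq0 ?lm.1 ?ll.1.
rewrite wD (has_weight_uniq fa (wlead_weight lm)).
by rewrite (has_weight_uniq gb (wlead_weight ll)).
Qed.

Lemma has_weight1 : has_weight w (1 : mseries n R) 0.
Proof.
split=> [|m]; last by [].
exists 0%MM; first by rewrite scoef1 eqxx oner_eq0.
by apply/(@addnI (w 0%MM)); rewrite -wD addm0 addn0.
Qed.

Lemma has_weightX f a e : has_weight w f a -> has_weight w (f ^+ e) (a * e).
Proof.
move=> fa; elim: e => [|e IHe]; first by rewrite muln0; apply: has_weight1.
by rewrite exprS mulnS; apply: has_weightM.
Qed.

Lemma has_weight_smon m : has_weight w (smon m : mseries n R) (w m).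
Proof.
split=> [|l]; first by exists m; rewrite // scoef_smon eqxx oner_eq0.
rewrite scoef_smon; by case: (l =P m) => [->|_]; rewrite ?eqxx.
Qed.

End Domain.

(** * The order filtration *)

Section Order.
Variables (n : nat) (R : idomainType).
Implicit Types (f g h : mseries n R) (m l : 'X_{1..n}) (a b N : nat).

(** Membership in the N-th power of the maximal ideal, see [ord_geS_decomp]. *)
Definition ord_ge N f := forall m, (mdeg m < N)%N -> scoef f m = 0.

Lemma ord_ge_all f : ord_ge 0 f.
Proof. by []. Qed.

Lemma ord_ge0 N : ord_ge N 0.
Proof. by []. Qed.

Lemma ord_geD N f g : ord_ge N f -> ord_ge N g -> ord_ge N (f + g).
Proof. by move=> Nf Ng m lm; rewrite scoefD Nf ?Ng ?addr0. Qed.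

Lemma ord_geN N f : ord_ge N f -> ord_ge N (- f).
Proof. by move=> Nf m lm; rewrite scoefN Nf ?oppr0. Qed.

Lemma ord_geB N f g : ord_ge N f -> ord_ge N g -> ord_ge N (f - g).
Proof. by move=> Nf Ng; apply/ord_geD/ord_geN. Qed.

Lemma ord_geZ N (c : R) f : ord_ge N f -> ord_ge N (c *: f).
Proof. by move=> Nf m lm; rewrite scoefZ Nf ?mulr0. Qed.

Lemma ord_ge_sum N (I : Type) (r : seq I) (P : pred I) (F : I -> mseries n R) :
  (forall i, P i -> ord_ge N (F i)) -> ord_ge N (\sum_(i <- r | P i) F i).
Proof. by move=> NF; elim/big_ind: _ => //; apply: ord_geD. Qed.

Lemma ord_geW a N f : (a <= N)%N -> ord_ge N f -> ord_ge a f.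
Proof. by move=> aN Nf m lm; apply: Nf; apply: leq_trans aN. Qed.

Lemma ord_geM a b f g : ord_ge a f -> ord_ge b g -> ord_ge (a + b) (f * g).
Proof.
have contra N h : ord_ge N h <-> (forall m, scoef h m != 0 -> (N <= mdeg m)%N).
  split=> H m; first by apply: contraNleq => /H ->.
  by rewrite ltnNge => lm; apply/eqP; apply: contraNT lm => /H.
move=> /contra fa /contra gb; apply/contra; apply: weight_ge fa gb.
exact: mdegD.
Qed.

Lemma ord_geX N f : ord_ge 1 f -> ord_ge N (f ^+ N).
Proof.
move=> f1; elim: N => // N IH; rewrite exprS -add1n; exact: ord_geM.
Qed.

Lemma ord_ge_eq0 f : (forall N, ord_ge N f) -> f = 0.
Proof. by move=> Nf; apply: mseriesP => m; apply: (Nf (mdeg m).+1). Qed.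

Lemma ord_ge_sub_const f : ord_ge 1 (f - (scoef f 0%MM) *: 1).
Proof.
move=> m; rewrite ltnS leqn0 mdeg_eq0 => /eqP ->.
by rewrite scoefB scoefZ scoef1 eqxx mulr1 subrr.
Qed.

(** Completeness of the ring of series, with control on the rate of convergence:
   the coefficients of degree d are final from step d + 1 on. *)
Lemma mseries_limit (N : nat -> nat) (g : nat -> mseries n R) :
    (forall s, N s < N s.+1)%N -> (forall s, ord_ge (N s) (g s.+1 - g s)) ->
  exists h, forall s, ord_ge (N s) (h - g s).
Proof.
move=> N_incr g_cauchy.
have N_mono s t : (s <= t)%N -> (N s <= N t)%N.
  move=> /subnKC <-; elim: (t - s)%N => [|d IH]; first by rewrite addn0.
  by rewrite addnS; apply: leq_trans IH (ltnW (N_incr _)).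
have geN s : (s <= N s)%N by elim: s => // s IH; exact: leq_ltn_trans IH (N_incr s).
have g_close s t : (s <= t)%N -> ord_ge (N s) (g t - g s).
  move=> /subnKC <-; elim: (t - s)%N => [|d IH].
    by rewrite addn0 subrr.
  rewrite addnS -[g _.+1](subrK (g (s + d)%N)) -addrA; apply: ord_geD => //.
  by apply: ord_geW (g_cauchy _); rewrite N_mono ?leq_addr.
exists (MSeries (fun m => scoef (g (mdeg m).+1) m)) => s m lm.
rewrite scoefB /=; have [le_s|/ltnW le_s] := leqP s (mdeg m).+1.
  by rewrite -scoefB g_close.
apply/eqP; rewrite -oppr_eq0 opprB -scoefB; apply/eqP.
by apply: (g_close _ _ le_s); apply: geN.
Qed.

(** The contraction principle on the maximal ideal, from which inverses and
   square roots of series with constant term 1 are obtained. *)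
Lemma mseries_fixpoint (T : mseries n R -> mseries n R) :
    (forall f, ord_ge 1 f -> ord_ge 1 (T f)) ->
    (forall N f g, ord_ge 1 f -> ord_ge 1 g ->
       ord_ge N (f - g) -> ord_ge N.+1 (T f - T g)) ->
  exists2 f, ord_ge 1 f & T f = f.
Proof.
move=> T1 T_contr; pose g s := iter s T 0.
have g1 s : ord_ge 1 (g s) by elim: s => //= s; apply: T1.
have g_cauchy s : ord_ge s.+1 (g s.+1 - g s).
  elim: s => [|s IH]; first by rewrite /= subr0; apply: T1.
  exact: (T_contr _ (g s.+1) (g s)).
have [f lim_f] := mseries_limit (fun s => ltnSn s.+1) g_cauchy.
have f1 : ord_ge 1 f by rewrite -[f]subr0; apply: (lim_f 0%N).
exists f => //; apply/eqP; rewrite -subr_eq0; apply/eqP/ord_ge_eq0 => N.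
rewrite -[T f](subrK (g N.+1)) -addrA; apply: ord_geD.
  by apply: (@ord_geW _ N.+2); [lia | apply: (T_contr _ f (g N))].
rewrite -opprB; apply: ord_geN; apply: ord_geW (lim_f _); lia.
Qed.

Lemma mseries_inv f : ord_ge 1 f ->
  exists2 g, ord_ge 1 g & (1 + f) * (1 + g) = 1.
Proof.
move=> f1.
have [g|N g h g1 h1 gh|g g1 gE] := @mseries_fixpoint (fun g => - f - f * g).
- by move=> g1; apply: ord_geB; [apply: ord_geN | apply: (@ord_geW _ 2) => //;
     apply: (@ord_geM 1 1)].
- have -> : - f - f * g - (- f - f * h) = - (f * (g - h)) by ring.
  by apply/ord_geN; rewrite -add1n; apply: ord_geM.
- exists g => //; have -> : (1 + f) * (1 + g) = 1 + (g - (- f - f * g)) by ring.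
  by rewrite gE subrr addr0.
Qed.

(** The equation 1 + f = (1 + g)^2 reads g = (f - g^2) / 2, a contraction. *)
Lemma mseries_sqrt (c : R) f : c * 2%:R = 1 -> ord_ge 1 f ->
  exists2 g, ord_ge 1 g & 1 + f = (1 + g) ^+ 2.
Proof.
move=> c2 f1.
have [g|N g h g1 h1 gh|g g1 gE] :=
  @mseries_fixpoint (fun g => c *: (f - g * g)).
- by move=> g1; apply/ord_geZ/ord_geB => //; apply: (@ord_geW _ 2) => //;
     apply: (@ord_geM 1 1).
- rewrite -scalerBr; apply: ord_geZ.
  have -> : f - g * g - (f - h * h) = - ((g + h) * (g - h)) by ring.
  by apply/ord_geN; rewrite -add1n; apply: ord_geM => //; apply: ord_geD.
- exists g => //.
  have -> : f = g * g + 2%:R * g.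
    rewrite -[in X in _ + X]gE -scalerAr mulr_natl -scaler_nat scalerA c2 scale1r.
    by rewrite addrC subrK.
  by ring.
Qed.

(** Each monomial of f is charged to the first variable that divides it, which
   makes the quotients F i well defined. Iterating, a series of order at least N
   is a combination of products of N variables. *)
Lemma ord_geS_decomp N f : ord_ge N.+1 f ->
  exists2 F : 'I_n -> mseries n R,
    f = \sum_(i < n) F i * svar i & forall i, ord_ge N (F i).
Proof.
move=> Nf; pose first_var (m : 'X_{1..n}) i :=
  (m i != 0%N) && [forall j : 'I_n, (j < i)%N ==> (m j == 0%N)].
exists (fun i => MSeries (fun m =>
  if first_var (m + U_(i))%MM i then scoef f (m + U_(i))%MM else 0)); last first.
  move=> i m lm /=; case: ifP => // _; apply: Nf.
  by rewrite mdegD mdeg1 addn1.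
apply: mseriesP => m.
have -> : scoef (\sum_(i < n) MSeries (fun l =>
     if first_var (l + U_(i))%MM i then scoef f (l + U_(i))%MM else 0) * svar i) m
   = \sum_(i < n) if first_var m i then scoef f m else 0.
  rewrite (big_morph (fun h => scoef h m) (fun g h => scoefD g h m)
    (scoef0 R m)).
  apply: eq_bigr => i _; rewrite -smonU scoef_mul_smon lep1mP /=.
  case: eqP => [mi|/eqP mi] /=; first by rewrite /first_var mi.
  by rewrite submK // lep1mP.
have [m0|] := eqVneq m 0%MM.
  by rewrite m0 Nf ?mdeg0 // big1 // => i _; rewrite if_same.
rewrite -mdeg_eq0 mdegE sum_nat_eq0 negb_forall => /existsP[i0 mi0].
have [i mi i_min] := @arg_minnP _ i0 (fun i => m i != 0%N) (@nat_of_ord n) mi0.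
rewrite (bigD1 i) //= /first_var mi /= ifT; last first.
  apply/forallP => j; apply/implyP; apply: contraLR.
  by rewrite -leqNgt => /i_min.
rewrite big1 ?addr0 // => j ji; case: ifP => // /andP[mj /forallP jmin].
have := i_min _ mj; rewrite leq_eqVlt => /orP[/eqP/val_inj ij|lt_ij].
  by rewrite ij eqxx in ji.
by have /implyP/(_ lt_ij) := jmin i; rewrite (negPf mi).
Qed.

End Order.

(** * Locally algebraic linear maps *)

Section PolynomialAction.
Variables (k : fieldType) (V : lmodType k) (T : {linear V -> V}).
Implicit Types (p q : {poly k}) (v : V).

(** The vector p(T) v. *)
Definition pact p v : V := \sum_(j < size p) p`_j *: iter j T v.

Lemma pactE d p v : (size p <= d)%N ->
  pact p v = \sum_(j < d) p`_j *: iter j T v.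
Proof.
move=> le_pd; rewrite /pact (big_ord_widen d (fun j => p`_j *: iter j T v)) //.
rewrite big_mkcond; apply: eq_bigr => i _; case: ltnP => // /(nth_default 0) ->.
by rewrite scale0r.
Qed.

Lemma iter_linear j (a : k) (u v : V) :
  iter j T (a *: u + v) = a *: iter j T u + iter j T v.
Proof. by elim: j => //= j ->; rewrite linearP. Qed.

Lemma pact_linear p (a : k) (u v : V) :
  pact p (a *: u + v) = a *: pact p u + pact p v.
Proof.
rewrite /pact scaler_sumr -big_split; apply: eq_bigr => i _ /=.
by rewrite iter_linear scalerDr !scalerA mulrC.
Qed.

Lemma pactD p u v : pact p (u + v) = pact p u + pact p v.
Proof. by rewrite -[u]scale1r pact_linear !scale1r. Qed.

Lemma pactBl p q v : pact (p - q) v = pact p v - pact q v.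
Proof.
pose d := maxn (size p) (size q).
have pd : (size p <= d)%N by rewrite leq_maxl.
have qd : (size q <= d)%N by rewrite leq_maxr.
have pqd : (size (p - q)%R <= d)%N.
  by rewrite (leq_trans (size_polyD _ _)) // size_polyN.
rewrite !(pactE (d := d)) // -sumrB; apply: eq_bigr => i _.
by rewrite coefB scalerBl.
Qed.

Lemma pactZl a p v : pact (a *: p) v = a *: pact p v.
Proof.
rewrite (pactE (d := size p)) ?size_scale_leq // /pact scaler_sumr.
by apply: eq_bigr => i _; rewrite coefZ scalerA.
Qed.

(** A finite-dimensional orbit satisfies a linear relation: d + 1 of its
   members have linearly dependent coordinates in a d-element spanning set. *)
Lemma finite_dimensional_pact v :
    finite_dimensional (lspan (range (fun m : nat => iter m T v))) ->
  exists2 p : {poly k}, p != 0 & pact p v = 0.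
Proof.
move=> [d [e spanE]].
have /choice[c cE] (m : nat) :
    exists c : 'I_d -> k, iter m T v = \sum_(i < d) c i *: e i.
  have : lspan (range e) (iter m T v).
    rewrite -spanE; exists 1%N, (fun=> 1), (fun=> iter m T v).
    by split=> [_|]; [exists m | rewrite big_ord1 scale1r].
  move=> [r [a [x [xe ->]]]].
  have /choice[h hE] (i : 'I_r) : exists j, e j = x i.
    by have [j _ <-] := xe i; exists j.
  exists (fun j => \sum_(i < r | h i == j) a i).
  under [RHS]eq_bigr do rewrite scaler_suml.
  rewrite (exchange_big_dep xpredT) //=; apply: eq_bigr => i _.
  by rewrite (big_pred1 (h i)) ?hE // => j; rewrite eq_sym.
pose M := \matrix_(i < d.+1, j < d) c i j.
have [i kerM] : exists i, row i (kermx M) != 0.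
  apply/existsP; rewrite -negb_forall; apply/negP => /forallP ker0.
  have : \rank (kermx M) = 0%N.
    by apply/eqP; rewrite mxrank_eq0; apply/eqP/row_matrixP => i;
      rewrite row0; apply/eqP.
  by rewrite mxrank_ker => /eqP; rewrite subn_eq0 leqNgt ltnS rank_leq_col.
have [r r0 rM] : exists2 r : 'rV_d.+1, r != 0 & r *m M = 0.
  by exists (row i (kermx M)); rewrite // -row_mul mulmx_ker row0.
exists (\poly_(j < d.+1) r 0 (inord j)).
  apply: contraNneq r0 => p0; apply/eqP/rowP => j.
  have := congr1 (fun p : {poly k} => p`_j) p0.
  rewrite coef_poly ltn_ord inord_val coef0.
  by move=> ->; rewrite mxE.
rewrite (pactE (d := d.+1)) ?size_poly //.
under eq_bigr => j _ do rewrite coef_poly ltn_ord inord_val cE scaler_sumr.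
rewrite exchange_big big1 // => j _ /=.
under eq_bigr do rewrite scalerA; rewrite -scaler_suml.
suff -> : \sum_(i < d.+1) r 0 i * c i j = 0 by rewrite scale0r.
have := congr1 (fun A : 'rV_d => A 0 j) rM; rewrite !mxE => rMj.
by rewrite -[RHS]rMj; apply: eq_bigr => l _; rewrite mxE.
Qed.

End PolynomialAction.

Section Kaplansky.
Variables (n : nat) (k : fieldType) (T : {linear mseries n k -> mseries n k}).
Implicit Types (f g : mseries n k) (p q : {poly k}) (N s : nat).
Hypothesis T_ord : forall N f, ord_ge N f -> ord_ge N (T f).

Lemma pact_ord N p f : ord_ge N f -> ord_ge N (pact T p f).
Proof.
move=> Nf; apply: ord_ge_sum => i _; apply: ord_geZ.
by elim: (i : nat) => //= j; apply: T_ord.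
Qed.

(** The first s terms of the orbit g, T g, T^2 g, ... are linearly independent
   modulo the N-th power of the maximal ideal. If T preserves these powers, a
   perturbation of g of order at least N does not affect this, so that the
   property survives in a limit. *)
Definition indep_mod s N g :=
  forall p, (size p <= s)%N -> ord_ge N (pact T p g) -> p = 0.

(** Only one more relation p, normalized by p_s = 1, can hold modulo order N
   among s + 1 terms of the orbit. If it holds exactly, a perturbation u with
   p(T) u <> 0 destroys it, and p(T) g' then has a finite order below N'. *)
Lemma indep_modS s N g :
    (forall p, p != 0 -> exists2 u, ord_ge N u & pact T p u != 0) ->
    indep_mod s N g ->
  exists N' g', [/\ (N < N')%N, ord_ge N (g' - g) & indep_mod s.+1 N' g'].
Proof.
move=> free ind.
have [[p [sz_p ps p_ord]]|no] := pselect (exists p,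
    [/\ (size p <= s.+1)%N, p`_s = 1 & ord_ge N (pact T p g)]); last first.
  exists N.+1, g; split; rewrite ?ltnSn ?subrr // => q sz_q q_ord.
  have {}q_ord : ord_ge N (pact T q g) by apply: ord_geW q_ord.
  have [qs|qs] := eqVneq q`_s 0.
    apply: ind q_ord; apply/leq_sizeP => j; rewrite leq_eqVlt => /predU1P[<-//|].
    by move: j; apply/leq_sizeP.
  case: no; exists ((q`_s)^-1 *: q); split.
  - exact: leq_trans (size_scale_leq _ _) sz_q.
  - by rewrite coefZ mulVf.
  - by rewrite pactZl; apply: ord_geZ.
have p0 : p != 0 by apply: contra_eq_neq ps => ->; rewrite coef0 eq_sym oner_eq0.
have [g' g'N pg'] : exists2 g', ord_ge N (g' - g) & pact T p g' != 0.
  have [pg|] := eqVneq (pact T p g) 0; last by exists g; rewrite ?subrr.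
  have [u Nu pu] := free p p0; exists (g + u); first by rewrite addrC addKr.
  by rewrite pactD pg add0r.
have [M pM] : exists M, ~ ord_ge M (pact T p g').
  apply: contrapT => /forallNP H; case/eqP: pg'.
  by apply: ord_ge_eq0 => M; apply: contrapT.
have g'g q : ord_ge N (pact T q g') -> ord_ge N (pact T q g).
  have -> : g = g' - (g' - g) by rewrite subKr.
  move=> qg'; rewrite pactD; apply: ord_geD => //; exact/pact_ord/ord_geN.
exists (maxn M N.+1), g'; split; rewrite ?leq_maxr // => q sz_q q_ord.
have q_ordN : ord_ge N (pact T q g').
  by apply: ord_geW q_ord; rewrite ltnW // leq_maxr.
have qE : q = q`_s *: p.
  apply/eqP; rewrite -subr_eq0; apply/eqP/ind.
    apply/leq_sizeP => j; rewrite leq_eqVlt coefB coefZ => /predU1P[<-|lt_sj].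
      by rewrite ps mulr1 subrr.
    have [qj pj] := (leq_trans sz_q lt_sj, leq_trans sz_p lt_sj).
    by rewrite (nth_default 0 qj) (nth_default 0 pj) mulr0 subrr.
  rewrite pactBl pactZl; apply: ord_geB; first exact: g'g.
  exact: ord_geZ.
have [qs|qs] := eqVneq q`_s 0; first by rewrite qE qs scale0r.
case: pM; have -> : p = (q`_s)^-1 *: q by rewrite {2}qE scalerA mulVf // scale1r.
by rewrite pactZl; apply: ord_geZ; apply: ord_geW q_ord; rewrite leq_maxl.
Qed.

(** If every nonzero p(T) is nonzero on every power of the maximal ideal, the
   preceding step can be repeated for ever, and the limit h satisfies no
   relation: one of degree d would already hold modulo the order reached at the
   step d + 1, where the first d + 1 terms are independent. *)
Lemma locally_algebraic_tail :
    (forall g, exists2 p, p != 0 & pact T p g = 0) ->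
  exists2 p, p != 0 & exists N, forall u, ord_ge N u -> pact T p u = 0.
Proof.
move=> loc; apply: contrapT => no.
have free N p : p != 0 -> exists2 u, ord_ge N u & pact T p u != 0.
  move=> p0; apply: contrapT => no_u; apply: no.
  exists p => //; exists N => u Nu.
  by apply/eqP/negPn/negP => pu; apply: no_u; exists u.
have /choice[step stepP] (x : nat * nat * mseries n k) :
    exists y : nat * nat * mseries n k, indep_mod x.1.1 x.1.2 x.2 ->
      [/\ y.1.1 = x.1.1.+1, (x.1.2 < y.1.2)%N, ord_ge x.1.2 (y.2 - x.2)
        & indep_mod y.1.1 y.1.2 y.2].
  case: x => -[s N] g /=.
  have [ind|nind] := pselect (indep_mod s N g); last first.
    by exists (0%N, 0%N, 0) => /nind.
  have [N' [g' [NN' gg' ind']]] := indep_modS (free N) ind.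
  by exists (s.+1, N', g').
pose x s := iter s step (0%N, 0%N, 0).
have xP s : (x s).1.1 = s /\ indep_mod s (x s).1.2 (x s).2.
  elim: s => [|s [xs ind]] /=.
    by split=> // p; rewrite leqn0 size_poly_eq0 => /eqP.
  have := stepP (x s); rewrite xs => /(_ ind)[e _ _].
  by rewrite e.
have xstep s : [/\ ((x s).1.2 < (x s.+1).1.2)%N
    & ord_ge (x s).1.2 ((x s.+1).2 - (x s).2)].
  have [xs ind] := xP s.
  by have := stepP (x s); rewrite xs => /(_ ind)[].
have [h hP] := @mseries_limit _ _ (fun s => (x s).1.2) (fun s => (x s).2)
  (fun s => proj1 (xstep s)) (fun s => proj2 (xstep s)).
have [p p0 ph] := loc h.
case/eqP: (p0); apply: (xP (size p)).2 => //.
have -> : (x (size p)).2 = h - (h - (x (size p)).2) by rewrite subKr.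
rewrite pactD ph add0r; apply/pact_ord/ord_geN/hP.
Qed.

End Kaplansky.

(** * Power sums without zero divisors *)

Definition no_zero_divisors (R : comNzRingType) :=
  forall x y : R, x * y = 0 -> x = 0 \/ y = 0.

(** Vandermonde without determinants: the hypothesis extends by linearity to
   sum_i p_i h_i^N Q(h_i) = 0 for every polynomial Q, in particular for the Q
   that vanishes at all values of h except v. *)
Lemma weighted_power_sums (R : comNzRingType) (I : finType) (h p : I -> R) N :
    no_zero_divisors R ->
    (forall e, (N <= e)%N -> \sum_i p i * h i ^+ e = 0) ->
  forall v, v != 0 -> \sum_(i | h i == v) p i = 0.
Proof.
move=> Rdom hp v v0.
have hpQ (Q : {poly R}) : \sum_i p i * h i ^+ N * Q.[h i] = 0.
  under eq_bigr do rewrite horner_coef mulr_sumr.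
  rewrite exchange_big big1 // => j _ /=.
  transitivity (Q`_j * \sum_i p i * h i ^+ (N + j)); last first.
    by rewrite hp ?mulr0 ?leq_addr.
  by rewrite mulr_sumr; apply: eq_bigr => i _; rewrite exprD; ring.
pose Q := \prod_(u <- [seq u <- undup (codom h) | u != v]) ('X - u%:P).
have QE x : Q.[x] = \prod_(u <- [seq u <- undup (codom h) | u != v]) (x - u).
  by rewrite horner_prod; apply: eq_bigr => u _; rewrite hornerXsubC.
have vQ0 : v ^+ N * Q.[v] != 0.
  have nz x y : x != 0 -> y != 0 -> x * y != 0 :> R.
    by move=> x0 y0; apply/eqP => /Rdom[] /eqP; apply/negP.
  apply: (nz (v ^+ N) Q.[v]).
    by elim: (N) => [|e IH]; rewrite ?expr0 ?oner_neq0 // exprS nz.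
  rewrite QE big_filter; elim/big_ind: _ => [|x y|u]; first exact: oner_neq0.
    exact: nz.
  by rewrite subr_eq0 eq_sym.
have := hpQ Q; rewrite (bigID (fun i => h i == v)) /= [X in _ + X]big1; last first.
  move=> i hi; rewrite QE (bigD1_seq (h i)) ?filter_uniq ?undup_uniq //=; last first.
    by rewrite mem_filter hi mem_undup codom_f.
  by rewrite subrr mul0r mulr0.
rewrite addr0 (eq_bigr (fun i => v ^+ N * Q.[v] * p i)) => [|i /eqP->]; last by ring.
by rewrite -mulr_sumr => /Rdom[] // /eqP; rewrite (negPf vQ0).
Qed.

(** * The Laurent ring *)

Section LaurentRing.
Variables (n : nat) (k : fieldType).
Local Notation S := (mseries n k).
Local Notation A := (laurent n k).
Local Notation tl := (@tolaurent n k).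
Implicit Types (f g : S) (u v : A).

Lemma laurent_smon_unit m : exists u, u * tl (smon m) = 1.
Proof.
rewrite /smon rmorph_prod /=; elim/big_ind: _ => [|x y [u ux] [v vy]|i _].
- by exists 1; rewrite mul1r.
- by exists (u * v); rewrite mulrACA ux vy mulr1.
have [u ui] := laurent_var_unit k i; exists (u ^+ m i).
by rewrite rmorphXn /= -exprMn ui expr1n.
Qed.

Lemma laurent_smonI m : injective (fun u => u * tl (smon m)).
Proof.
have [w wm] := laurent_smon_unit m.
by move=> u v /(congr1 ( *%R^~ w)) /=; rewrite -!mulrA (mulrC _ w) wm !mulr1.
Qed.

Lemma laurent_domain : no_zero_divisors A.
Proof.
move=> u v uv; have [f [m fE]] := laurent_fracP u.
have [g [l gE]] := laurent_fracP v.
have : f * g = 0.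
  apply/(@tolaurent_inj n k).
  by rewrite rmorphM /= -fE -gE mulrACA uv mul0r rmorph0.
move/eqP; have [f0 _|f0] := eqVneq f 0.
  by left; apply: (@laurent_smonI m); rewrite fE f0 mul0r rmorph0.
have [g0 _|g0] := eqVneq g 0; last by rewrite (negPf (mseries_mulf_neq0 f0 g0)).
by right; apply: (@laurent_smonI l); rewrite gE g0 mul0r rmorph0.
Qed.

(** The x_i-adic valuation of an infinitely 2-divisible element is an integer
   divisible by all powers of 2, hence 0. With u = F / x^m, this says that F has
   x_i-adic valuation m_i for each i, so that x^m divides F. *)
Lemma infinitely_divisible_integral u : u != 0 ->
    (forall e, exists v, u = v ^+ (2 ^ e)) ->
  exists f, u = tl f.
Proof.
move=> u0 roots; have [F [m FE]] := laurent_fracP u.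
have F0 : F != 0.
  apply: contraNneq u0 => F0; apply/eqP/(@laurent_smonI m).
  by rewrite FE F0 mul0r rmorph0.
have wF (i : 'I_n) : has_weight (fun l : 'X_{1..n} => l i) F (m i).
  have wD (l l' : 'X_{1..n}) : (l + l')%MM i = (l i + l' i)%N by rewrite mnmDE.
  have [a wa] := has_weight_exists (fun l : 'X_{1..n} => l i) F0.
  suff -> : m i = a by [].
  (* Any e with a, m i < 2^e will do: a and m i are congruent modulo 2^e. *)
  pose e := (m i + a)%N; have [v uv] := roots e.
  have [G [l GE]] := laurent_fracP v.
  have eqFG : F * smon l ^+ (2 ^ e) = G ^+ (2 ^ e) * smon m.
    apply: (@tolaurent_inj n k); rewrite !rmorphM !rmorphXn /= -FE -GE exprMn uv.
    by rewrite mulrAC.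
  have G0 : G != 0.
    apply: contraNneq F0 => G0; rewrite -(inj_eq (@tolaurent_inj n k)) -FE uv.
    have -> : v = 0 by apply: (@laurent_smonI l); rewrite GE G0 mul0r rmorph0.
    by rewrite expr0n expn_eq0 /= mul0r rmorph0.
  have [b wb] := has_weight_exists (fun l : 'X_{1..n} => l i) G0.
  have wl := has_weightX wD (2 ^ e)
    (has_weight_smon k (fun l : 'X_{1..n} => l i) l).
  have wm := has_weight_smon k (fun l : 'X_{1..n} => l i) m.
  have := has_weightM wD wa wl; rewrite eqFG.
  have wGm := has_weightM wD (has_weightX wD (2 ^ e) wb) wm.
  move=> /(has_weight_uniq wGm) /esym.
  move/(congr1 (modn^~ (2 ^ e)%N)); rewrite addnC !modnMDl.
  have lt_e := ltn_expl e (isT : 1 < 2)%N.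
  by rewrite !modn_small //; rewrite (leq_ltn_trans _ lt_e) ?leq_addl ?leq_addr.
exists (MSeries (fun l => scoef F (l + m)%MM)); apply: (@laurent_smonI m).
rewrite FE -rmorphM; congr (tl _); apply: mseriesP => l; rewrite scoef_mul_smon /=.
case: ifPn => [/submK-> //|]; rewrite /lem negb_forall => /existsP[i].
rewrite -ltnNge => lt_i; apply/eqP.
by apply: contraTT lt_i => /(wF i).2; rewrite -leqNgt.
Qed.

End LaurentRing.

(** * Endomorphisms of the Laurent ring *)

Section Endomorphism.
Variables (n : nat) (k : fieldType) (c : k).
Hypothesis c2 : c * 2%:R = 1.
Local Notation S := (mseries n k).
Local Notation A := (laurent n k).
Local Notation tl := (@tolaurent n k).
Variable phi : {lrmorphism A -> A}.
Implicit Types (f g : S) (u v : A).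

Lemma one_plus_divisible f e : ord_ge 1 f ->
  exists2 g, ord_ge 1 g & 1 + f = (1 + g) ^+ (2 ^ e).
Proof.
elim: e f => [|e IH] f f1; first by exists f.
have [g g1 ->] := mseries_sqrt c2 f1; have [h h1 ->] := IH g g1.
by exists h; rewrite // -exprM -expnSr.
Qed.

Lemma phi_one_plus f : ord_ge 1 f -> exists g, phi (tl (1 + f)) = tl g.
Proof.
move=> f1; apply: infinitely_divisible_integral => [|e].
  have [g _ fg] := mseries_inv f1; apply/eqP => phi0.
  have : phi (tl (1 + f)) * phi (tl (1 + g)) = 1.
    by rewrite -!rmorphM /= fg !rmorph1.
  by rewrite phi0 mul0r => /eqP; rewrite eq_sym oner_eq0.
have [g _ ->] := one_plus_divisible e f1.
by exists (phi (tl (1 + g))); rewrite -!rmorphXn.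
Qed.

(** If the constant term of phi f were a <> 0, then 1 - f / a would be a unit
   of S whose image and the inverse of whose image are series, the former
   without constant term. *)
Lemma phi_max_ideal f : ord_ge 1 f -> exists2 g, ord_ge 1 g & phi (tl f) = tl g.
Proof.
move=> f1; have [g gE] : exists g, phi (tl f) = tl g.
  have [g gE] := phi_one_plus f1; exists (g - 1).
  by rewrite rmorphB rmorph1 /= -gE !rmorphD !rmorph1 addrC addKr.
exists g => // m; rewrite ltnS leqn0 mdeg_eq0 => /eqP ->.
apply/eqP/negPn/negP => g0; pose a := - (scoef g 0%MM)^-1.
have af1 : ord_ge 1 (a *: f) by apply: ord_geZ.
have [h h1 fh] := mseries_inv af1; have [G GE] := phi_one_plus h1.
have ag1 : ord_ge 1 (1 + a *: g).
  move=> l; rewrite ltnS leqn0 mdeg_eq0 => /eqP ->.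
  by rewrite scoefD scoefZ scoef1 eqxx /a mulNr mulVf // subrr.
have agG : (1 + a *: g) * G = 1.
  apply: (@tolaurent_inj n k).
  rewrite rmorphM rmorphD rmorph1 /= linearZ /= -gE -GE -linearZ /= -linearZ /=.
  rewrite -{1}(rmorph1 phi) -rmorphD -{1}(rmorph1 tl) -rmorphD -!rmorphM /=.
  by rewrite fh !rmorph1.
have := ord_geM ag1 (@ord_ge_all _ _ G); rewrite agG => /(_ 0%MM).
by rewrite mdeg0 scoef1 eqxx => /(_ isT)/eqP; rewrite oner_eq0.
Qed.

(** The image of a series of order at least N has order at least N because the
   latter is a combination of products of N elements of the maximal ideal, none
   of which leaves that ideal. *)
Lemma phi_restricts : exists psi : {lrmorphism S -> S},
  (forall f, phi (tl f) = tl (psi f)) /\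
  (forall N f, ord_ge N f -> ord_ge N (psi f)).
Proof.
have /choice[psi psiE] f : exists g, phi (tl f) = tl g.
  have [g _ gE] := phi_max_ideal (ord_ge_sub_const f).
  move: gE; move: (scoef f 0%MM) => a gE; exists (g + a *: 1).
  rewrite -[in LHS](subrK (a *: 1) f) rmorphD /= rmorphD /= gE.
  by rewrite rmorphD /= !linearZ /= !rmorph1.
have psi_linear : linear psi.
  move=> a f g; apply: (@tolaurent_inj n k).
  by rewrite -psiE !linearP /= !psiE.
have psi_monoid : monoid_morphism psi.
  split=> [|f g]; apply: (@tolaurent_inj n k); first by rewrite -psiE !rmorph1.
  by rewrite -psiE !rmorphM /= !psiE.
pose psiL := GRing.isLinear.Build k S S *:%R psi psi_linear.
pose psiM := GRing.isMonoidMorphism.Build S S psi psi_monoid.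
pose Psi : {lrmorphism S -> S} := HB.pack psi psiL psiM.
have psi1 f : ord_ge 1 f -> ord_ge 1 (psi f).
  by case/phi_max_ideal=> g g1; rewrite psiE => /(@tolaurent_inj n k) ->.
exists Psi; split=> //; elim=> [//|N IH] f /ord_geS_decomp[F -> FN].
rewrite rmorph_sum; apply: ord_ge_sum => i _; rewrite rmorphM -addn1.
apply: ord_geM; first exact: IH.
apply: psi1 => m; rewrite ltnS leqn0 mdeg_eq0 => /eqP ->.
by rewrite /= eq_sym mnm1_eq0.
Qed.

End Endomorphism.

(** * Eventual periodicity *)

Lemma iter_morph (T T' : Type) (F : T -> T) (G : T' -> T') (h : T -> T') :
  (forall x, G (h x) = h (F x)) -> forall j x, iter j G (h x) = h (iter j F x).
Proof. by move=> GhF; elim=> //= j IH x; rewrite IH GhF. Qed.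

Lemma iter_monoid_morphism (R : pzSemiRingType) (F : {rmorphism R -> R}) j :
  monoid_morphism (iter j F).
Proof.
elim: j => // j [IH1 IHM].
by split=> [|x y] /=; rewrite ?IH1 ?IHM (rmorph1, rmorphM).
Qed.

(** The factorial makes the preperiod and the period depend only on the bound D
   and no longer on x. *)
Lemma iter_eq_period (T : Type) (F : T -> T) x i j D :
    (i < j)%N -> (j <= D)%N -> iter i F x = iter j F x ->
  iter D F x = iter (D + D`!) F x.
Proof.
move=> ij jD eq_ij.
have per d : (i <= d)%N -> iter (d + (j - i)) F x = iter d F x.
  move=> id; rewrite -{1}(subnK id) -addnA subnKC ?(ltnW ij) // iterD -eq_ij.
  by rewrite -iterD subnK.
have per_mul t : iter (D + t * (j - i)) F x = iter D F x.
  elim: t => [|t IH]; first by rewrite mul0n addn0.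
  rewrite mulSn addnCA addnC per // -?IH //.
  by rewrite (leq_trans _ (leq_addr _ _)) // (leq_trans (ltnW ij)).
have /dvdnP[t ->] : (j - i %| D`!)%N by apply: dvdn_fact; lia.
by rewrite per_mul.
Qed.

Lemma two_invertible (k : fieldType) : [pchar k] =i pred0 ->
  exists c : k, c * 2%:R = 1.
Proof.
by move=> /pcharf0P k0; exists 2%:R^-1; rewrite mulVf // k0.
Qed.

(** The polynomial p that annihilates psi on high order series is independent of
   f, and so is the bound that it gives on the preperiod and the period. *)
Lemma locally_finite_eventually_periodic (k : fieldType) (n : nat)
    (phi : {lrmorphism laurent n k -> laurent n k}) :
    [pchar k] =i pred0 -> locally_finite phi ->
  exists D, (0 < D)%N /\ iter D phi =1 iter (D + D`!) phi.
Proof.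
move=> k0 phi_lf; have [c c2] := two_invertible k0.
have [psi [psiE psi_ord]] := phi_restricts c2 phi.
have iterE j f : iter j phi (tolaurent f) = tolaurent (iter j psi f).
  exact: iter_morph.
have iterM j : {morph iter j phi : u v / u * v}.
  exact: (iter_monoid_morphism phi j).2.
have iterX j f e : iter j psi (f ^+ e) = iter j psi f ^+ e.
  have [psi1 psiM] := iter_monoid_morphism psi j.
  by elim: e => [|e IH]; rewrite ?expr0 ?exprS ?psi1 // psiM IH.
have loc (g : mseries n k) : exists2 p : {poly k}, p != 0 & pact psi p g = 0.
  have [p p0 pg] := finite_dimensional_pact (phi_lf (tolaurent g)).
  exists p => //; apply: (@tolaurent_inj n k); rewrite rmorph0 -pg /pact linear_sum.
  by apply: eq_bigr => j _; rewrite linearZ /= iterE.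
have [p p0 [N pN]] := locally_algebraic_tail psi_ord loc.
have max_per f : ord_ge 1 f -> exists i j,
    [/\ (i < j)%N, (j <= size p)%N & iter i psi f = iter j psi f].
  move=> f1; pose h (j : 'I_(size p)) := iter j psi f.
  have sums e : (N <= e)%N -> \sum_(j < size p) (p`_j *: 1) * h j ^+ e = 0.
    move=> Ne; rewrite -[RHS](pN (f ^+ e)); last exact: ord_geW Ne (ord_geX f1).
    by apply: eq_bigr => j _; rewrite mulr_algl iterX.
  (* The leading coefficient of p is a nonzero weight, so the last term of the
     orbit is either 0 or shared with an earlier one. *)
  have lt_p : ((size p).-1 < size p)%N by rewrite prednK // size_poly_gt0.
  pose j0 := Ordinal lt_p.
  have S_dom : no_zero_divisors (mseries n k).
    move=> x y /eqP; have [->|x0] := eqVneq x 0; first by left.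
    have [->|y0] := eqVneq y 0; first by right.
    by rewrite (negPf (mseries_mulf_neq0 x0 y0)).
  have [h0|h0] := eqVneq (h j0) 0.
    exists (size p).-1, (size p).-1.+1; split=> //=.
    by have := h0; rewrite /h /= => ->; rewrite rmorph0.
  have := weighted_power_sums S_dom sums h0.
  rewrite (bigD1 j0) //= => sum0.
  have [j /andP[/eqP hj jj0]] : exists j, (h j == h j0) && (j != j0).
    apply/existsP; apply: contraTT p0 => /existsPn no.
    rewrite negbK -lead_coef_eq0 lead_coefE; move: sum0; rewrite big_pred0 => [|j].
      by rewrite addr0 => /eqP; rewrite scaler_eq0 oner_eq0 orbF.
    exact/negbTE/no.
  exists j, (size p).-1; split=> //; last exact: leq_pred.
  by move: jj0 (ltn_ord j); rewrite -val_eqE /=; lia.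
exists (size p); split; first by rewrite size_poly_gt0.
set D := size p.
have per f : iter D psi f = iter (D + D`!) psi f.
  have [i [j [ij jD eq_ij]]] := max_per _ (ord_ge_sub_const f).
  have := iter_eq_period ij jD eq_ij.
  have iter_sub e : iter e psi (f - scoef f 0%MM *: 1)
      = iter e psi f - scoef f 0%MM *: 1.
    by elim: e => //= e ->; rewrite linearB linearZ /= rmorph1.
  by rewrite !iter_sub => /addIr.
have perA f : iter D phi (tolaurent f) = iter (D + D`!) phi (tolaurent f).
  by rewrite !iterE per.
move=> u; have [f [m fE]] := laurent_fracP u.
have [w wm] := laurent_smon_unit k m.
have iter1 j : iter j phi 1 = 1 by exact: (iter_monoid_morphism phi j).1.
have inv j : iter j phi w * iter j phi (tolaurent (smon m)) = 1.
  by rewrite -iterM wm iter1.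
have -> : u = tolaurent f * w by rewrite -fE -mulrA (mulrC _ w) wm mulr1.
rewrite !iterM perA; congr (_ * _).
by rewrite -[LHS]mulr1 -(inv (D + D`!)) mulrCA -perA inv mulr1.
Qed.

(** * The image of 1 - phi *)

Section MathieuZhaoImage.
Variables (k : fieldType) (A : comAlgType k) (phi : {lrmorphism A -> A}).
Variables i q : nat.
Hypotheses (k0 : [pchar k] =i pred0) (A_dom : no_zero_divisors A).
Hypotheses (q_gt0 : (0 < q)%N) (per : iter i phi =1 iter (i + q) phi).

Local Notation M := (range (fun a : A => a - phi a)).

Lemma image_subspace : is_subspace M.
Proof.
split=> [|c u v [a _ <-] [b _ <-]]; first by exists 0; rewrite // rmorph0 subrr.
by exists (c *: a + b); rewrite // linearP /= scalerBr; ring.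
Qed.

Lemma image_sub_iter t a : M (a - iter t phi a).
Proof.
elim: t => [|t IH]; first by rewrite subrr; case: image_subspace.
have := image_subspace.2 1 _ _ IH (ex_intro2 _ _ (iter t phi a) I erefl).
by rewrite scale1r addrA subrK.
Qed.

(** Put y = phi^i a. Modulo the image of 1 - phi, each iterate of an element is
   equivalent to that element, so a is equivalent to y and q y to the sum of the
   iterates of y, which vanishes by hypothesis; and q is invertible in k. *)
Lemma image_sum0P a : M a <-> \sum_(t < q) iter (i + t) phi a = 0.
Proof.
split=> [[b _ <-]|sum0].
  transitivity
      (\sum_(0 <= t < q) (iter (i + t) phi b - iter (i + t.+1) phi b)).
    rewrite big_mkord; apply: eq_bigr => t _; rewrite addnS iterSr.
    by elim: (i + t)%N => [|j IH] //=; rewrite IH rmorphB.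
  apply: oppr_inj; rewrite -sumrN.
  under eq_bigr do rewrite opprB.
  rewrite (telescope_sumr (fun t => iter (i + t) phi b)) //.
  by rewrite addn0 -per subrr oppr0.
pose y := iter i phi a.
have q0 : q%:R != 0 :> k by rewrite (proj1 (pcharf0P k) k0) -lt0n.
have sum_y : q%:R *: y = \sum_(t < q) (y - iter t phi y).
  rewrite sumrB sumr_const card_ord scaler_nat.
  suff -> : \sum_(t < q) iter t phi y = 0 by rewrite subr0.
  by rewrite -[RHS]sum0; apply: eq_bigr => t _; rewrite -iterD addnC.
have My : M (q%:R *: y).
  rewrite sum_y; elim/big_ind: _ => [|u v Mu Mv|t _]; last exact: image_sub_iter.
  - exact: image_subspace.1.
  - by rewrite -[u]scale1r; apply: image_subspace.2.
have := image_subspace.2 q%:R^-1 _ _ My (image_sub_iter i a).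
by rewrite scalerA mulVf // scale1r -/y addrC subrK.
Qed.

(** Characteristic zero forbids a positive number of equal nonzero terms to
   cancel in the power sums, so all iterates phi^(i + t) a vanish. *)
Lemma MZ_image : MZ_space M.
Proof.
split; first exact: image_subspace.
move=> a b [N aN]; exists 1%N => // m m_gt0; apply/image_sum0P.
have sums e : (N <= e)%N -> \sum_(t < q) 1 * iter (i + t) phi a ^+ e = 0.
  move=> /aN/image_sum0P sum0; rewrite -[RHS]sum0; apply: eq_bigr => t _.
  have [phi1 phiM] := iter_monoid_morphism phi (i + t).
  elim: e {sum0} => [|e IH]; first by rewrite !expr0 mulr1 phi1.
  by rewrite !exprS phiM -IH !mul1r.
have a0 t : (t < q)%N -> iter (i + t) phi a = 0.
  move=> tq; apply/eqP/negPn/negP => /(weighted_power_sums A_dom sums)/eqP.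
  rewrite sumr_const -scaler_nat scaler_eq0 oner_eq0 orbF (proj1 (pcharf0P k) k0).
  rewrite -leqn0 leqNgt; apply/negP/negPn/card_gt0P.
  by exists (Ordinal tq); apply/eqP.
rewrite big1 // => t _; rewrite (iter_monoid_morphism phi _).2 -(prednK m_gt0) exprS.
by rewrite (iter_monoid_morphism phi _).2 a0 // mul0r mulr0.
Qed.

End MathieuZhaoImage.

Theorem theorem3p2 (k : fieldType) (k_char0 : [pchar k] =i pred0) (n : nat)
    (phi : {lrmorphism laurent n k -> laurent n k})
    (phi_lf : locally_finite phi) :
  (exists i j : nat, [/\ (1 <= i)%N, (i < j)%N & iter i phi =1 iter j phi])
  /\ MZ_space (range (fun a : laurent n k => a - phi a)).
Proof.
have [D [D_gt0 per]] := locally_finite_eventually_periodic k_char0 phi_lf.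
split.
  exists D, (D + D`!)%N; split=> //.
  by rewrite -[X in (X < _)%N]addn0 ltn_add2l fact_gt0.
exact: (@MZ_image _ _ phi D D`! k_char0 (@laurent_domain n k) (fact_gt0 D) per).
Qed.
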